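(* Let $\alpha$ be a real number with $\alpha\in[0,\frac{1}{2}]$, and let $G$ be a connected 1-binding graph of even order $n$ with $n\geq n(\alpha)$, where $n(\alpha)=\max\{18,\frac{2+8\alpha}{1-2\alpha}\}$ if $\alpha\in[0,\frac{1}{2})$, and $n(\alpha)=18$ if $\alpha=\frac{1}{2}$. If $$\rho_{\alpha}(G)\geq\rho_{\alpha}(K_1\vee(K_{n-5}\cup K_3\cup K_1)),$$ then $G$ has a perfect matching, unless $G=K_1\vee(K_{n-5}\cup K_3\cup K_1)$.
   Context: All graphs are finite, simple and undirected. For a graph $G$ and $X\subseteq V(G)$, $N_G(X)$ denotes the set of neighbors of $X$ in $G$. The binding number of $G$ is $\mathrm{bind}(G)=\min\{|N_G(X)|/|X| : \emptyset\neq X\subseteq V(G),\ N_G(X)\neq V(G)\}$; $G$ is 1-binding if $\mathrm{bind}(G)\geq 1$. For $\alpha\in[0,1]$, the $A_\alpha$-matrix of $G$ is $A_\alpha(G)=\alpha D(G)+(1-\alpha)A(G)$, where $A(G)$ is the adjacency matrix and $D(G)$ the diagonal matrix of vertex degrees; $\rho_\alpha(G)$ denotes the largest eigenvalue of $A_\alpha(G)$. $K_m$ is the complete graph on $m$ vertices; $G_1\cup G_2$ is the disjoint union, and $G_1\vee G_2$ is the join (disjoint union plus all edges between $V(G_1)$ and $V(G_2)$). A perfect matching is a set of pairwise nonadjacent edges covering every vertex. *)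

(* Defs.v *)
From HB Require Import structures.
From mathcomp Require Import all_boot all_order all_algebra.
From mathcomp Require Import fingroup perm reals.
Set Implicit Arguments. Unset Strict Implicit. Unset Printing Implicit Defensive.
Import Order.TTheory GRing.Theory Num.Theory.
Local Open Scope ring_scope.

Section Graphs.
Variable T : finType.

Definition simple_graph (G : rel T) : Prop :=
  symmetric G /\ irreflexive G.

Definition connected_graph (G : rel T) : Prop :=
  forall x y : T, connect G x y.

Definition nbhd (G : rel T) (X : {set T}) : {set T} :=
  [set y | [exists x in X, G x y]].

(* bind(G) >= 1, i.e. min { |N(X)|/|X| : X nonempty, N(X) <> V } >= 1 *)
Definition one_binding (G : rel T) : Prop :=
  forall X : {set T}, X != set0 -> nbhd G X != setT -> (#|X| <= #|nbhd G X|)%N.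

Definition perfect_matching (G : rel T) (M : {set {set T}}) : Prop :=
  (forall e, e \in M -> exists x y, [/\ G x y & e = [set x; y]]) /\
  (forall v : T, exists! e, e \in M /\ v \in e).

Definition has_perfect_matching (G : rel T) : Prop :=
  exists M, perfect_matching G M.

Definition deg (G : rel T) (v : T) : nat := #|[set w | G v w]|.

End Graphs.

Definition isomorphic (n : nat) (G H : rel 'I_n) : Prop :=
  exists f : {perm 'I_n}, forall x y, G x y = H (f x) (f y).

Definition A_alpha (R : numFieldType) (n : nat) (alpha : R) (G : rel 'I_n)
  : 'M[R]_n :=
  \matrix_(i, j) (alpha * ((i == j)%:R * (deg G i)%:R)
                  + (1 - alpha) * (G i j)%:R).

Definition is_largest_eigenvalue (R : realType) (n : nat) (A : 'M[R]_n) (r : R)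
  : Prop :=
  eigenvalue A r /\ forall s : R, eigenvalue A s -> s <= r.

(* K_1 \/ (K_{n-5} u K_3 u K_1) on vertex set 'I_n:
   vertex 0 = the K_1 joined to everything, 1..n-5 = K_{n-5},
   n-4..n-2 = K_3, n-1 = the isolated K_1 of the union. *)
Definition blk (n i : nat) : nat :=
  if (i <= n - 5)%N then 0%N else if (i <= n - 2)%N then 1%N else 2%N.

Definition special_graph (n : nat) : rel 'I_n :=
  fun x y => (x != y) &&
    [|| (val x == 0%N), (val y == 0%N) | blk n (val x) == blk n (val y)].
Arguments special_graph n : clear implicits.

(* Main.v *)
Require Import Defs.
From HB Require Import structures.
From mathcomp Require Import all_boot all_order all_algebra.
From mathcomp Require Import fingroup perm reals.
From mathcomp Require Import zify ring lra.
Import Order.TTheory GRing.Theory Num.Theory.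
Set Implicit Arguments. Unset Strict Implicit. Unset Printing Implicit Defensive.

(** If G has no perfect matching, then (Tutte, in Lovasz's edge-maximal form) G
    lies in a graph G' for which some vertex set S of size s has at least s + 2
    odd components in G' - S, all components being cliques.  Connectedness gives
    s >= 1, and 1-binding allows at most s singleton components, so every
    component leaves at least s + 3 of the other n - s vertices uncovered.

    All spectral estimates are of Collatz-Wielandt type: if y > 0 and
    A_alpha y <= t y entrywise, then every eigenvalue is at most t, and for
    connected G equality forces A_alpha y = t y.  The Perron root of
    H = K_1 \/ (K_{n-5} u K_3 u K_1) exceeds n - 5.  Either s = 1 and G is a
    spanning subgraph of H, in which case the Perron vector of H is a test vector
    for G; or a vector with one value on S and another off S shows that all
    eigenvalues of G are at most n - 5.  The one case where n - 5 is too small a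
    bound is n = 18, s = 6, alpha = 1/2, where 66/5 separates G from H. *)

(** * Perfect matchings and alternating walks *)

Local Open Scope nat_scope.

Section Matchings.
Variable T : finType.
Implicit Types (G : rel T) (m : {ffun T -> T}) (A S E : {set T}).

(** A perfect matching is encoded as the involution exchanging partners; in a simple graph
    irreflexivity rules out fixed points. *)
Definition perfect_invol G m := [forall v, G v (m v) && (m (m v) == v)].
Definition has_pm G := [exists m, perfect_invol G m].

Lemma perfect_involP G m :
  reflect ((forall v, G v (m v)) /\ involutive m) (perfect_invol G m).
Proof.
apply: (iffP forallP) => [h|[h1 h2] v]; last by rewrite h1 h2 eqxx.
by split=> v; have /andP[// _ /eqP] := h v.
Qed.

Lemma has_pm_perfect_matching G : has_pm G -> has_perfect_matching G.
Proof.
case/existsP=> m /perfect_involP[Gm mK].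
exists [set [set v; m v] | v in T]; split=> [e /imsetP[v _ ->]|v].
  by exists v, (m v).
exists [set v; m v]; split; first by split; [apply/imsetP; exists v|rewrite !inE eqxx].
move=> e [/imsetP[w _ ->]]; rewrite !inE => /orP[/eqP-> //|/eqP->].
by rewrite mK setUC.
Qed.

(** The orbits of [f] split [A] into pairs; the induction strips one pair at a time. *)
Lemma odd_card_invol (f : T -> T) A :
  {in A, forall v, f v \in A} -> {in A, forall v, f v != v} ->
  {in A, forall v, f (f v) = v} -> ~~ odd #|A|.
Proof.
have [k] := ubnP #|A|; elim: k A => // k IH A leAk fA f1 fK.
have [->|[a aA]] := set_0Vmem A; first by rewrite cards0.
have fa := fA a aA; have nfa := f1 a aA.
have faA : f a \in A :\ a by rewrite in_setD1 nfa.
rewrite (cardsD1 a) aA (cardsD1 (f a) (A :\ a)) faA /= negbK.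
apply: IH => [||v|v]; rewrite ?inE.
- by move: leAk; rewrite (cardsD1 a) aA (cardsD1 (f a) (A :\ a)) faA; lia.
- move=> v; rewrite !inE => /and3P[vfa va vA]; rewrite fA // andbT.
  apply/andP; split; first by apply: contraNneq va => h; rewrite -(fK v vA) h fK.
  by apply: contraNneq vfa => <-; rewrite fK.
- by case/and3P=> _ _ /f1.
- by case/and3P=> _ _ /fK.
Qed.

Definition add_edge G a b : rel T :=
  fun u v => [|| G u v, (u == a) && (v == b) | (u == b) && (v == a)].

Lemma add_edge_simple G a b :
  simple_graph G -> a != b -> simple_graph (add_edge G a b).
Proof.
move=> [Gs Gi] ab; split=> [u v|u]; rewrite /add_edge.
  by rewrite Gs [(u == a) && _]andbC [(u == b) && _]andbC [X in _ || X]orbC.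
rewrite Gi /=; case: eqP => [->|_]; rewrite ?(negPf ab) //=.
by rewrite andbF.
Qed.

(** Edges are added as long as no perfect matching appears; the number of non-adjacent pairs drops
    each time. *)
Lemma saturation G : simple_graph G -> ~~ has_pm G ->
  exists G', [/\ simple_graph G', subrel G G', ~~ has_pm G' &
    forall a b, a != b -> ~~ G' a b -> has_pm (add_edge G' a b)].
Proof.
have [k] := ubnP #|[set p : T * T | ~~ G p.1 p.2]|.
elim: k G => // k IH G leGk Gsimp npm.
have [/existsP[a /existsP[b /and3P[ab nab np]]]|] :=
  boolP [exists a, exists b, [&& a != b, ~~ G a b & ~~ has_pm (add_edge G a b)]].
  have [] := IH _ _ (add_edge_simple Gsimp ab) np.
    move: leGk; rewrite ltnS; apply: leq_trans; apply: proper_card.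
    apply/properP; split.
      by apply/subsetP=> p; rewrite !inE /add_edge => /norP[].
    by exists (a, b); rewrite !inE //= /add_edge !eqxx orbT.
  move=> G' [G's sub np' sat]; exists G'; split=> // u v uv.
  by apply: sub; rewrite /add_edge uv.
move=> h; exists G; split=> // a b ab nab; apply: contraNT h => np.
by apply/existsP; exists a; apply/existsP; exists b; rewrite ab nab.
Qed.

(** A perfect matching that avoids the new edge would already be one of [G]. *)
Lemma add_edge_pm G a b m : ~~ has_pm G -> perfect_invol (add_edge G a b) m ->
  [/\ m a = b, m b = a & forall v, v != a -> v != b -> G v (m v)].
Proof.
move=> npm /perfect_involP[Gm mK].
have H v : v != a -> v != b -> G v (m v).
  by move=> /negPf va /negPf vb; have := Gm v; rewrite /add_edge va vb !orbF.
have mab : m a = b.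
  apply/eqP; apply: contraNT npm => mab; apply/existsP; exists m.
  apply/perfect_involP; split=> // v; have := Gm v; rewrite /add_edge.
  case/or3P=> // /andP[/eqP-> /eqP e]; first by rewrite e eqxx in mab.
  by rewrite -e mK eqxx in mab.
by split; rewrite // -mab mK.
Qed.

(* An alternating walk leaving w along m1 traverses A and first meets {x, y, z}
   at x: switch to m1 on A and to the edge xy. *)
Lemma exchange_at G (m1 m2 : {ffun T -> T}) A (x y z w : T) :
  simple_graph G -> involutive m1 -> involutive m2 -> G x y ->
  (forall v, v != x -> v != z -> G v (m1 v)) ->
  (forall v, v != y -> v != w -> G v (m2 v)) ->
  {in A, forall v, m1 v \in A} ->
  {in A, forall v, m2 v \in x |: (y |: A)} ->
  m2 x \in x |: (y |: A) -> m2 y \in x |: (y |: A) ->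
  w \in A -> x \notin A -> y \notin A -> z \notin A -> has_pm G.
Proof.
move=> [Gs Gi] m1K m2K Gxy G1 G2 A1 A2 A2x A2y wA xA yA zA.
have xy : x != y by apply: contraTneq Gxy => ->; rewrite Gi.
apply/existsP.
exists [ffun v => if v \in A then m1 v else if v == x then y else
   if v == y then x else m2 v].
have yx : (y == x) = false by rewrite eq_sym; exact/negbTE.
have A2' v : v \in x |: (y |: A) -> m2 v \in x |: (y |: A).
  by rewrite !inE => /or3P[/eqP->|/eqP->|vA]; have := A2 v; rewrite ?inE in A2x A2y *; auto.
apply/perfect_involP; split=> v; rewrite !ffunE.
  case: ifP => vA.
    by apply: G1; apply: contraTneq vA => ->.
  case: eqP => [->//|vx]; case: eqP => [->|vy]; first by rewrite Gs.
  by apply: G2; [apply/eqP|apply: contraFneq vA => ->].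
have [vA|/negbTE vA] := boolP (v \in A); first by rewrite A1 // m1K.
have [->|vx] := eqVneq v x; first by rewrite (negPf yA) yx eqxx.
have [->|vy] := eqVneq v y; first by rewrite (negPf xA) eqxx.
have: v \notin x |: (y |: A) by rewrite !inE (negPf vx) (negPf vy) vA.
have [h|h _] := boolP (m2 v \in x |: (y |: A)).
  by rewrite -[v]m2K A2'.
move: h; rewrite !inE => /norP[/negPf-> /norP[/negPf-> /negPf->]].
exact: m2K.
Qed.

(** Lovasz's exchange argument. Take perfect matchings [m1] of G + xz and [m2] of G + yw, and follow
    the alternating walk from [w], starting along [m1], until it meets x, y or z. Switching along
    this walk avoids both added edges. *)
Lemma exchange G x y z w : simple_graph G ->
  G x y -> G y z -> x != z -> y != w -> ~~ G y w ->
  has_pm (add_edge G x z) -> has_pm (add_edge G y w) -> has_pm G.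
Proof.
move=> Gsimp Gxy Gyz xz yw nyw /existsP[m1 pm1] /existsP[m2 pm2].
have [//|npm] := boolP (has_pm G); exfalso.
have [m1x m1z G1] := add_edge_pm npm pm1.
have [m2y m2w G2] := add_edge_pm npm pm2.
have [Gs Gi] := Gsimp.
case/perfect_involP: pm1 => /= G1' m1K; case/perfect_involP: pm2 => /= G2' m2K.
have wx : w != x by apply: contraNneq nyw => ->; rewrite Gs.
have wz : w != z by apply: contraNneq nyw => ->.
have xy : x != y by apply: contraTneq Gxy => ->; rewrite Gi.
have zy : z != y by apply: contraTneq Gyz => ->; rewrite Gi.
have m1n v : m1 v != v.
  by apply: contraTneq (G1' v) => ->; rewrite (proj2 (add_edge_simple Gsimp xz)).
have m2n v : m2 v != v.
  by apply: contraTneq (G2' v) => ->; rewrite (proj2 (add_edge_simple Gsimp yw)).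
pose u := fix u (j : nat) : T := if j is j'.+1 then (if odd j' then m2 (u j') else m1 (u j')) else w.
have uS j : u j.+1 = if odd j then m2 (u j) else m1 (u j) by [].
(* Two steps of the walk apply the injective map [p], so the walk returns to [w], and the vertex
   just before that is [m2 w], which is [y]. Hence {x, y, z} is met. *)
pose p (v : T) : T := m2 (m1 v).
have u2 i : u i.*2 = iter i p w.
  elim: i => // i IH; rewrite doubleS 2!uS /= odd_double /= IH //.
have injp : injective p by apply: inj_comp; apply: can_inj.
have [j0 hit0] : exists j, u j \in [:: x; y; z].
  have := fingraph.iter_order injp w; have := fingraph.order_gt0 p w.
  case: (fingraph.order p w) => // k _ /= /(congr1 m2); rewrite /p m2K m2w -/p -u2 => e.
  by exists k.*2.+1; rewrite uS odd_double e !inE eqxx orbT.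
case: (ex_minnP (ex_intro (fun j => u j \in [:: x; y; z]) j0 hit0)) => j hit minj.
have nohit i : i < j -> u i \notin [:: x; y; z].
  by rewrite ltnNge; apply: contra; exact: minj.
have j0' : 0 < j.
  case: (j) hit => //=; rewrite !inE (negPf wx) (negPf wz) eq_sym (negPf yw) //.
pose A := [set u i | i : 'I_j].
have uA i : i < j -> u i \in A by move=> ij; exact: (imset_f (fun i : 'I_j => u i) (x := Ordinal ij)).
have AP v : v \in A -> exists2 i, i < j & v = u i.
  by case/imsetP=> i _ ->; exists i.
have wA : w \in A := uA 0 j0'.
have nA v : v \in [:: x; y; z] -> v \notin A.
  by move=> vh; apply/negP => /AP[i ij e]; have := nohit i ij; rewrite -e vh.
have xA : x \notin A by apply: nA; rewrite !inE eqxx.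
have yA : y \notin A by apply: nA; rewrite !inE eqxx orbT.
have zA : z \notin A by apply: nA; rewrite !inE eqxx !orbT.
have m2A v : v \in A -> m2 v \in u j |: (y |: A).
  case/AP=> i ij ->; case oi: (odd i).
    have -> : m2 (u i) = u i.+1 by rewrite uS oi.
    by rewrite !inE; have [->|ne] := eqVneq i.+1 j; rewrite ?eqxx // uA ?orbT // ltn_neqAle ne.
  case: i ij oi => [|i] ij oi; first by rewrite /= m2w !inE eqxx orbT.
  have -> : m2 (u i.+1) = u i by move: oi; rewrite uS /= => /negbFE->; rewrite m2K.
  by rewrite !inE (uA i) ?orbT // ltnW.
(* The last step is along [m1], which swaps x and z, so arriving at one of them would mean an
   earlier visit to the other; the walk ends at [y]. Then [y |: A] is closed under both matchings,
   contains y and w but neither x nor z, and one uses [m1] on it and [m2] off it. *)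
case oj: (odd j).
  have ej : m1 (u j) = u j.-1.
    by case: (j) j0' oj => // j' _ /= /negbTE ->; rewrite m1K.
  have uj : u j = y.
    have := nohit j.-1; rewrite ltn_predL j0' -ej !inE => /(_ isT).
    by move: hit; rewrite !inE => /or3P[] /eqP->;
       rewrite ?m1x ?m1z ?eqxx ?orbT.
  case/negP: npm; apply/existsP.
  have B1 v : v \in y |: A -> m1 v \in y |: A.
    rewrite !in_setU1 => /orP[/eqP->|/AP[i ij ->]].
      by rewrite -uj ej uA ?orbT // ltn_predL.
    case oi: (odd i).
      case: i ij oi => // i ij /= /negbTE oi.
      by rewrite oi m1K uA ?orbT // ltnW.
    have -> : m1 (u i) = u i.+1 by rewrite uS oi.
    have [->|ne] := eqVneq i.+1 j; first by rewrite uj eqxx.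
    by rewrite uA ?orbT // ltn_neqAle ne.
  have B2 v : v \in y |: A -> m2 v \in y |: A.
    rewrite in_setU1 => /orP[/eqP->|/m2A]; first by rewrite m2y in_setU1 wA orbT.
    by rewrite uj setUA setUid.
  exists [ffun v => if v \in y |: A then m1 v else m2 v].
  apply/perfect_involP; split=> v; rewrite !ffunE;
    have [vA|/negbTE vA] := boolP (v \in y |: A).
  - apply: G1; apply: contraTneq vA => ->; rewrite in_setU1 negb_or.
      by rewrite xy.
    by rewrite zy.
  - by apply: G2; apply: contraFneq vA => ->; rewrite in_setU1 ?eqxx ?wA ?orbT.
  - by rewrite B1 // m1K.
  - case: ifP => [h|_]; last exact: m2K.
    by move: vA; rewrite -[v]m2K B2.
(* For even [j] the set [A] is closed under [m1]. Ending at x or z is the situation of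
   [exchange_at]; ending at y is impossible, since [m1] would pair up [A] and [m2] would pair up
   [y |: A]. *)
have A1 : {in A, forall v, m1 v \in A}.
  move=> v /AP[i ij ->]; case oi: (odd i).
    by case: i ij oi => // i ij /= /negbTE oi; rewrite oi m1K uA // ltnW.
  have -> : m1 (u i) = u i.+1 by rewrite uS oi.
  by rewrite uA //; rewrite ltn_neqAle ij andbT; apply: contraFneq oj => <-; rewrite /= oi.
have ej : m2 (u j) \in A.
  case: (j) j0' oj uA => // j' _ /= /negbFE oj uA'; rewrite oj m2K; exact: uA'.
move: hit; rewrite !inE => /or3P[] /eqP uj.
- case/negP: npm; apply: (@exchange_at G m1 m2 A x y z w) => //.
  + by move=> v /m2A; rewrite uj.
  + by rewrite -uj !inE ej !orbT.
  + by rewrite m2y !inE wA !orbT.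
- have e1 : ~~ odd #|A| by apply: (@odd_card_invol m1) => // v _.
  have : ~~ odd #|y |: A|.
    apply: (@odd_card_invol m2) => // v.
    rewrite in_setU1 => /orP[/eqP->|/m2A]; first by rewrite m2y in_setU1 wA orbT.
    by rewrite uj setUA setUid.
  by rewrite cardsU1 yA /= e1.
- case/negP: npm; apply: (@exchange_at G m1 m2 A z y x w) => //.
  + by rewrite Gs.
  + by move=> v vz vx; apply: G1.
  + by move=> v /m2A; rewrite uj.
  + by rewrite -uj !inE ej !orbT.
  + by rewrite m2y !inE wA !orbT.
Qed.

End Matchings.

(** * Maximum matchings and Tutte sets *)

Section MaximumMatchings.
Variables (T : finType) (G : rel T).
Hypothesis Gsimp : simple_graph G.
Implicit Types m : {ffun T -> T}.

(* A matching is an involution; its fixed points are the unmatched vertices. *)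
Definition matching m := [forall v, (m (m v) == v) && ((m v == v) || G v (m v))].
Definition unmatched m := [set v | m v == v].
Definition maximum m :=
  matching m /\ forall m', matching m' -> #|unmatched m| <= #|unmatched m'|.

Lemma matchingP m :
  reflect (involutive m /\ forall v, m v != v -> G v (m v)) (matching m).
Proof.
apply: (iffP forallP) => [h|[h1 h2] v].
  split=> v; have /andP[/eqP // _] := h v.
  by case: eqP.
by rewrite h1 eqxx /=; case: eqP => //= /eqP; exact: h2.
Qed.

Lemma exists_maximum : exists m, maximum m.
Proof.
have m0 : matching [ffun v => v].
  by apply/matchingP; split=> v; rewrite !ffunE ?eqxx.
case: (arg_minnP (fun m => #|unmatched m|) m0) => m mm min.
by exists m; split.
Qed.

Lemma maximum_indep m u v :
  maximum m -> u \in unmatched m -> v \in unmatched m -> ~~ G u v.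
Proof.
have [Gs Gi] := Gsimp.
move=> [/matchingP[mK Gm] mmax]; rewrite !inE => /eqP mu /eqP mv.
apply/negP => Guv.
have uv : u != v by apply: contraTneq Guv => ->; rewrite Gi.
pose m' := [ffun w => if w == u then v else if w == v then u else m w].
have vu : (v == u) = false by rewrite eq_sym; apply/negbTE.
have mm' : matching m'.
  apply/matchingP; split=> w; rewrite !ffunE.
    have [->|wu] := eqVneq w u; first by rewrite vu eqxx.
    have [->|wv] := eqVneq w v; first by rewrite eqxx.
    rewrite !ifN ?mK //; first by apply: contra_neq wv => e; rewrite -(mK w) e mv.
    by apply: contra_neq wu => e; rewrite -(mK w) e mu.
  have [->//|wu] := eqVneq w u.
  by have [->//|wv] := eqVneq w v; [rewrite Gs|exact: Gm].
have := mmax m' mm'; apply/negP; rewrite -ltnNge; apply: proper_card.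
apply/properP; split; last first.
  by exists u; rewrite !inE ?ffunE ?eqxx ?mu ?eqxx // eq_sym.
apply/subsetP => w; rewrite !inE !ffunE.
have [->|wu] := eqVneq w u; first by rewrite mu eqxx.
by have [->|wv] := eqVneq w v; first by rewrite mv eqxx.
Qed.

(** Trading the edge from [s] to [m s] for the edge from [u] to [s] keeps the size of the matching
    and moves the hole from [u] to [m s]. *)
Lemma maximum_rotate m u s :
  maximum m -> u \in unmatched m -> G u s -> m s != s ->
  exists m', [/\ maximum m', unmatched m' = m s |: (unmatched m :\ u)
    & forall w, w != u -> w != s -> w != m s -> m' w = m w].
Proof.
have [Gs Gi] := Gsimp.
move=> [/matchingP[mK Gm] mmax]; rewrite !inE => /eqP mu Gus mss.
have us : u != s by apply: contraTneq Gus => ->; rewrite Gi.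
have msu : m s != u by apply: contra_neq us => e; rewrite -[s]mK e mu.
pose m' := [ffun w => if w == u then s else if w == s then u else
  if w == m s then w else m w].
have um' : unmatched m' = m s |: (unmatched m :\ u).
  apply/setP=> w; rewrite !inE !ffunE.
  have [->|wu] := eqVneq w u.
    by rewrite eq_sym (negPf us) eq_sym (negPf msu).
  have [->|ws] := eqVneq w s.
    by rewrite (negPf us) (negPf mss) eq_sym (negPf mss).
  by have [->|wms] := eqVneq w (m s); rewrite ?eqxx.
exists m'; split=> //; last first.
  by move=> w; rewrite ffunE => /negPf-> /negPf-> /negPf->.
split.
  apply/matchingP; split=> w; rewrite !ffunE.
    have [->|wu] := eqVneq w u; first by rewrite eq_sym (negPf us) eqxx.
    have [->|ws] := eqVneq w s; first by rewrite eqxx.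
    have [->|wms] := eqVneq w (m s); first by rewrite (negPf msu) (negPf mss) eqxx.
    rewrite !ifN ?mK //.
    + by rewrite (can_eq mK).
    + by apply: contra_neq wms => <-; rewrite mK.
    + by apply: contra_neq wu => e; rewrite -(mK w) e mu.
  have [->//|wu] := eqVneq w u; have [->//|ws] := eqVneq w s; first by rewrite Gs.
  by have [->|wms] := eqVneq w (m s); rewrite ?eqxx //; exact: Gm.
move=> m2 /mmax; apply: leq_trans; rewrite um'.
have -> : #|unmatched m| = (#|unmatched m :\ u|).+1.
  by rewrite (cardsD1 u) inE mu eqxx.
by rewrite cardsU1; case: (_ \notin _); rewrite ?add0n ?add1n.
Qed.

(** Otherwise u, a, m a, v is an augmenting path: after rotating the hole from [u] to [m a], two
    holes would be adjacent. *)
Lemma maximum_no_path3 m u v a :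
  maximum m -> u \in unmatched m -> v \in unmatched m -> u != v ->
  G u a -> m a != a -> ~~ G (m a) v.
Proof.
move=> mm uU vU uv Gua maa.
have [m' [mm' U' _]] := maximum_rotate mm uU Gua maa.
apply: (maximum_indep mm'); rewrite U' ?setU11 //.
by rewrite in_setU1 in_setD1 vU (eq_sym v u) uv orbT.
Qed.

(** * Odd components outside the set of universal vertices *)

Section Structure.
Variable S : {set T}.
Hypothesis Suniv : forall s v, s \in S -> s != v -> G s v.
Hypothesis Ntrans : forall v, v \notin S ->
  forall x z, G x v -> G v z -> x != z -> G x z.

(** Adjacency is transitive off [S] by [Ntrans], so for v outside [S] this closed neighbourhood is
    the whole component of v in G - S. *)
Definition block v := [set w | (w \notin S) && ((w == v) || G v w)].

(** [E] consists of the holes together with the partners of [S]. As [S] is universal and there are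
    two holes, every vertex of [S] is matched, and matched to a vertex outside [S], which gives the
    count. *)
Lemma maximum_structure m : maximum m -> 2 <= #|unmatched m| ->
  exists E : {set T}, [/\ #|S| + 2 <= #|E|, {in E, forall e, e \notin S},
    {in E &, forall e f, ~~ G e f} & {in E, forall e, odd #|block e|}].
Proof.
have [Gs Gi] := Gsimp.
move=> mm /card_gt1P[u [v [uU vU uv]]].
have [/matchingP[mK Gm] mmax] := mm.
have other x : exists2 y, y \in unmatched m & y != x.
  by have [<-|] := eqVneq u x; [exists v; rewrite // eq_sym|exists u].
have US x : x \in unmatched m -> x \notin S.
  move=> xU; have [y yU yx] := other x; apply/negP => xS.
  by have := maximum_indep mm xU yU; rewrite Suniv // eq_sym.
have Sm s : s \in S -> m s != s.
  by move=> sS; apply: contraTneq sS => e; apply: US; rewrite inE e.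
have SmS s : s \in S -> m s \notin S.
  move=> sS; apply/negP => msS.
  have us : s != u by apply: contraTneq sS => ->; exact: US.
  have := maximum_no_path3 mm uU vU uv (a := s); rewrite Gs Suniv // Sm //.
  rewrite (Suniv msS) //; first by move=> /(_ isT isT).
  by apply: contraTneq msS => ->; exact: US.
(* Two adjacent vertices of E would give an augmenting path. *)
pose E := unmatched m :|: [set m s | s in S].
have EP e : e \in E -> e \in unmatched m \/ exists2 s, s \in S & e = m s.
  by rewrite inE => /orP[|/imsetP]; [left|right].
have ES e : e \in E -> e \notin S.
  by move=> /EP[/US//|[s /SmS ? ->]].
have EUS e s : e \in unmatched m -> s \in S -> ~~ G e (m s).
  move=> eU sS; apply/negP => Ge; have [y yU ye] := other e.
  have := maximum_no_path3 mm eU yU _ Ge; rewrite mK eq_sym ye eq_sym Sm //.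
  by rewrite Suniv; [move=> /(_ isT isT)| |apply: contraTneq sS => ->; exact: US].
have Eind e f : e \in E -> f \in E -> ~~ G e f.
  move=> /EP[eU|[s sS ->]] /EP[fU|[s' s'S ->]].
  - exact: (maximum_indep mm eU fU).
  - exact: EUS.
  - by rewrite Gs EUS.
  have [<-|ss'] := eqVneq s s'; first by rewrite Gi.
  apply/negP => Gss'.
  have sx x : x \in unmatched m -> forall s, s \in S -> s != x.
    by move=> xU t tS; apply: contraTneq tS => ->; exact: US.
  (* Rotating the hole from [u] to [m s] through the universal vertex [s] turns m s, m s', s', v
     into an augmenting path. *)
  have Gus : G u s by rewrite Gs Suniv // sx.
  have [m' [mm' U' m'E]] := maximum_rotate mm uU Gus (Sm s sS).
  have e1 : m' (m s') = s'.
    rewrite m'E ?mK //.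
    + by apply: contraTneq uU => <-; rewrite inE mK eq_sym Sm.
    + by apply: contraNneq (SmS _ s'S) => ->.
    + by rewrite (can_eq mK) eq_sym.
  have msU : m s \in unmatched m' by rewrite U' setU11.
  have vU' : v \in unmatched m' by rewrite U' in_setU1 in_setD1 vU (eq_sym v u) uv orbT.
  have msv : m s != v by apply: contraTneq vU => <-; rewrite inE mK eq_sym Sm.
  have := maximum_no_path3 mm' msU vU' msv Gss'.
  rewrite e1 (Suniv s'S (sx v vU s' s'S)) eq_sym Sm //.
  by move=> /(_ isT).
exists E; split=> //.
- rewrite cardsU card_imset; last exact: can_inj mK.
  have -> : unmatched m :&: [set m s | s in S] = set0.
    apply/setP=> x; rewrite !inE; apply/andP => -[/eqP mx /imsetP[s sS xE]].
    by move: (Sm s sS); rewrite -xE -mx xE mK eqxx.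
  rewrite cards0 subn0 addnC leq_add2r; apply/card_gt1P.
  by exists u, v.
move=> e eE.
(* The block of [e] contains no other member of [E], so its remaining vertices are matched among
   themselves and are even in number. *)
rewrite (cardsD1 e) !inE eqxx ES //= -/(block e).
apply: (@odd_card_invol _ m) => w; last by rewrite mK.
  rewrite !inE => /and3P[we wS]; rewrite (negPf we) /= => Gew.
  have wE : w \notin E by apply/negP => wE; move: (Eind _ _ eE wE); rewrite Gew.
  have mwS : m w \notin S.
    by apply: contra wE => mwS; rewrite inE; apply/orP; right; rewrite -[w]mK imset_f.
  have mww : m w != w by apply: contra wE => /eqP h; rewrite !inE h eqxx.
  have mwe : m w != e.
    apply/eqP => h; case/EP: eE => [|[s sS es]].
      by rewrite inE -h mK h (negPf we).
    by move: wS; rewrite -[w]mK h es mK sS.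
  rewrite mwS (negPf mwe) /=; apply: (Ntrans wS) => //; first exact: Gm.
  by rewrite eq_sym.
rewrite !inE => /and3P[we wS]; rewrite (negPf we) /= => Gew.
apply/negP => h; have wE : w \in E by rewrite !inE h.
by move: (Eind _ _ eE wE); rewrite Gew.
Qed.

End Structure.
End MaximumMatchings.

(** In a saturated supergraph let [S] be the set of universal vertices. A vertex off [S] misses some
    w, so [exchange] shows that any two of its neighbours are adjacent. *)
Lemma tutte_structure (T : finType) (G : rel T) :
  simple_graph G -> ~~ has_pm G -> ~~ odd #|T| ->
  exists (G' : rel T) (S E : {set T}),
  [/\ simple_graph G' /\ subrel G G',
      forall v, v \notin S -> forall x z, G' x v -> G' v z -> x != z -> G' x z,
      #|S| + 2 <= #|E|,
      {in E, forall e, e \notin S} /\ {in E &, forall e f, ~~ G' e f} &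
      {in E, forall e, odd #|block G' S e|}].
Proof.
move=> Gsimp npm oddT.
have [G' [Gsimp' sub npm' sat]] := saturation Gsimp npm.
have [Gs Gi] := Gsimp'.
pose S := [set v | [forall u, (v != u) ==> G' v u]].
have Suniv s v : s \in S -> s != v -> G' s v.
  by rewrite inE => /forallP/(_ v)/implyP.
have trans v : v \notin S -> forall x z, G' x v -> G' v z -> x != z -> G' x z.
  rewrite inE negb_forall => /existsP[w]; rewrite negb_imply => /andP[vw nvw] x z xv vz xz.
  apply: contraNT npm' => nxz.
  by apply: (exchange Gsimp' xv vz xz vw nvw); apply: sat.
have [m mm] := exists_maximum G'.
have [/matchingP[mK Gm] _] := mm.
(* The matched vertices pair up, so the number of holes is even, and it is not zero. *)
have U2 : 2 <= #|unmatched m|.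
  have := @odd_card_invol _ m (~: unmatched m).
  have e : #|~: unmatched m| = #|T| - #|unmatched m| by rewrite -(cardsC (unmatched m)) addKn.
  have le := max_card (mem (unmatched m)).
  rewrite e oddB // (negPf oddT) /= => h.
  have {}h : ~~ odd #|unmatched m|.
    by apply: h => v; rewrite !inE ?mK // eq_sym.
  have : #|unmatched m| != 0.
    apply: contra npm'; rewrite cards_eq0 => /eqP U0; apply/existsP; exists m.
    apply/perfect_involP; split=> // v; apply: Gm.
    by apply/negP => mv; have := in_set0 v; rewrite -U0 inE mv.
  by move: h; case: #|_| => [|[]].
have [E [cE ES Ei Eo]] := maximum_structure Gsimp' Suniv trans mm U2.
by exists G', S, E; split.
Qed.

(** * Component sizes in 1-binding graphs *)

Section Blocks.
Variables (T : finType) (G : rel T) (S E : {set T}).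
Hypothesis Gsimp : simple_graph G.
Hypothesis Ntrans : forall v, v \notin S ->
  forall x z, G x v -> G v z -> x != z -> G x z.
Hypothesis ES : {in E, forall e, e \notin S}.
Hypothesis Eind : {in E &, forall e f, ~~ G e f}.
Hypothesis Eodd : {in E, forall e, odd #|block G S e|}.
Local Notation block := (block G S).

Lemma block_refl v : v \notin S -> v \in block v.
Proof. by move=> vS; rewrite inE vS eqxx. Qed.

Lemma block_closed u v w : u \in block v -> G u w -> w \notin S -> w \in block v.
Proof.
rewrite !inE => /andP[uS /orP[/eqP->|Gvu]] Guw wS; rewrite wS ?Guw ?orbT //=.
have [//|wv] := eqVneq w v; apply: (Ntrans uS Gvu Guw); by rewrite eq_sym.
Qed.

Lemma block_sym u v : v \notin S -> u \in block v -> v \in block u.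
Proof.
have [Gs Gi] := Gsimp.
by move=> vS; rewrite !inE vS => /andP[_ /orP[/eqP->|]]; rewrite ?eqxx // Gs => ->; rewrite orbT.
Qed.

Lemma block_sub u v : u \in block v -> block u \subset block v.
Proof.
move=> uv; apply/subsetP => w; rewrite inE => /andP[wS /orP[/eqP->//|Guw]].
exact: block_closed uv Guw wS.
Qed.

Lemma block_eq u v : v \notin S -> u \in block v -> block u = block v.
Proof.
move=> vS uv; apply/eqP; rewrite eqEsubset block_sub //=.
by apply: block_sub; exact: block_sym.
Qed.

Lemma block_disjoint u v w : u \notin S -> v \notin S ->
  w \in block u -> w \in block v -> u \in block v.
Proof.
by move=> uS vS wu wv; rewrite -(block_eq vS wv) (block_eq uS wu) block_refl.
Qed.

Lemma E_block_inj e f w :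
  e \in E -> f \in E -> w \in block e -> w \in block f -> e = f.
Proof.
move=> eE fE we wf.
have := block_disjoint (ES eE) (ES fE) we wf.
by rewrite inE (negPf (Eind fE eE)) orbF => /andP[_ /eqP].
Qed.

Lemma card_EI_block v : v \notin S -> #|E :&: block v| <= 1.
Proof.
move=> vS; apply/card_le1_eqP => e f; rewrite !in_setI.
move=> /andP[eE ev] /andP[fE fv].
exact: (E_block_inj fE eE (block_sym vS fv) (block_sym vS ev)).
Qed.

Lemma sum_card_block (E' X : {set T}) : E' \subset E ->
  {in E', forall e, block e \subset X} -> \sum_(e in E') #|block e| <= #|X|.
Proof.
move=> /subsetP E'E E'X.
have h e : e \in E' -> #|block e| = \sum_(u in X) (u \in block e).
  move=> /E'X sub; rewrite -sum1_card big_mkcond [RHS]big_mkcond /=.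
  apply: eq_bigr => u _; have := subsetP sub u.
  by case: (u \in block e) => [->//|_]; case: ifP.
rewrite (eq_bigr _ h) exchange_big /= -sum1_card; apply: leq_sum => u _.
rewrite -big_mkcondr /= sum1_card; apply/card_le1_eqP => e f.
rewrite !unfold_in => /andP[eE eu] /andP[fE fu].
exact: (E_block_inj (E'E _ fE) (E'E _ eE) fu eu).
Qed.

Definition singles := [set e in E | #|block e| == 1].
Hypothesis few_singles : #|singles| <= #|S|.

(** Blocks of distinct members of [E] are disjoint and of odd size, hence have at least 3 vertices
    except for at most |S| singletons, each of which falls short by 2. *)
Lemma card_union_blocks (E' X : {set T}) : E' \subset E ->
  {in E', forall e, block e \subset X} -> 3 * #|E'| <= #|X| + 2 * #|S|.
Proof.
move=> E'E E'X.
apply: leq_trans (leq_add (sum_card_block E'E E'X) (leq_mul (leqnn 2) few_singles)).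
have le1 : \sum_(e in E') (#|block e| == 1) <= #|singles|.
  rewrite -big_mkcondr /= sum1_card subset_leq_card //.
  by apply/subsetP => e; rewrite !inE => /andP[/(subsetP E'E) -> ->].
apply: leq_trans (leq_add (leqnn _) (leq_mul (leqnn 2) le1)).
rewrite (mulnC 3) -sum_nat_const big_distrr -big_split /=.
apply: leq_sum => e /(subsetP E'E)/Eodd; case: #|_| => [|[|[|k]]] //.
Qed.

Hypothesis cardE : #|S| + 2 <= #|E|.

Lemma card_T_ge : 2 * #|S| + 6 <= #|T|.
Proof.
have := @card_union_blocks E (~: S) (subxx _).
have -> : #|~: S| = #|T| - #|S| by rewrite -(cardsC S) addKn.
have := max_card (mem S).
move=> h1 h2; suff: 3 * #|E| <= #|T| - #|S| + 2 * #|S|.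
  move: cardE h1; clear; set s := #|S|; set e := #|E|; set t := #|T|; lia.
apply: h2 => e _; apply/subsetP => w; by rewrite !inE => /andP[].
Qed.

Lemma block_subC v : v \notin S -> {in E :\: block v, forall e,
  block e \subset ~: (S :|: block v)}.
Proof.
move=> vS e; rewrite in_setD => /andP[ev eE]; apply/subsetP => w we.
rewrite in_setC in_setU negb_or; move: (we); rewrite {1}inE => /andP[-> _] /=.
by apply: contra ev => wv; exact: (block_disjoint (ES eE) vS we).
Qed.

Lemma cardsU_block v : #|S :|: block v| = #|S| + #|block v|.
Proof.
rewrite cardsU; suff -> : S :&: block v = set0 by rewrite cards0 subn0.
by apply/setP=> w; rewrite !inE; case: (w \in S).
Qed.

Lemma card_SU_block v : #|S| + #|block v| + #|~: (S :|: block v)| = #|T|.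
Proof. by rewrite -cardsU_block cardsC. Qed.

Lemma card_ED_block v : v \notin S -> #|S| + 1 <= #|E :\: block v|.
Proof.
move=> vS; have := card_EI_block vS; rewrite cardsD; move: cardE; lia.
Qed.

(** At least |S| + 1 blocks of [E] avoid [block v]; [card_union_blocks] counts them in the
    complement of S and [block v]. *)
Lemma card_block_le v : v \notin S -> #|block v| + 2 * #|S| + 3 <= #|T|.
Proof.
move=> vS; have h1 := card_ED_block vS.
have := @card_union_blocks (E :\: block v) _ (subsetDl _ _) (block_subC vS).
have := card_SU_block v; move: h1; lia.
Qed.

(** An even block contains no member of [E], so all |S| + 2 odd blocks lie outside it. *)
Lemma card_even_block_le v : v \notin S -> ~~ odd #|block v| ->
  #|block v| + 2 * #|S| + 6 <= #|T|.
Proof.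
move=> vS ov.
have h : E :\: block v = E.
  apply/setDidPl; rewrite disjoint_subset; apply/subsetP => e eE.
  apply/negP => ev; move: (Eodd eE); rewrite (block_eq vS) ?(negPf ov) //.
have := @card_union_blocks (E :\: block v) _ (subsetDl _ _) (block_subC vS).
have := card_SU_block v; rewrite h; move: cardE; lia.
Qed.

(** Four vertices remain, and they contain at least two odd blocks of which at most one is a
    singleton; another one has size 3. *)
Lemma exists_triple v : #|S| = 1 -> v \notin S -> #|block v| + 5 = #|T| ->
  exists e, [/\ e \notin S, #|block e| = 3 & [disjoint block e & block v]].
Proof.
move=> s1 vS cv.
have h1 := card_ED_block vS.
have : exists2 e, e \in E :\: block v & e \notin singles.
  apply/subsetPn; apply/negP => /subset_leq_card.
  move: few_singles h1; lia.
case=> e eEv; have eE : e \in E by move: eEv; rewrite inE => /andP[].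
rewrite inE eE /= => ne1; exists e; split; first exact: ES.
  have := subset_leq_card (block_subC vS eEv); have := card_SU_block v.
  move: ne1 (Eodd eE); rewrite s1; move: cv.
  case: #|block e| => [|[|[|[|[|k]]]]] //; lia.
rewrite disjoint_subset; apply/subsetP => w /(subsetP (block_subC vS eEv)).
by rewrite !inE negb_or => /andP[].
Qed.

Lemma block_outdeg v : v \notin S ->
  (#|[set u | (u \notin S) && G v u]|).+1 <= #|block v|.
Proof.
move=> vS; rewrite (cardsD1 v (block v)) block_refl // add1n ltnS.
apply/subset_leq_card/subsetP => u; rewrite !inE => /andP[-> Gvu]; rewrite Gvu orbT !andbT.
by apply: contraTneq Gvu => ->; rewrite (proj2 Gsimp).
Qed.

End Blocks.

(* Label 0 is the centre, and labels 1, 2, 3 the cliques K_{n-5}, K_3, K_1. *)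
Definition special_labelling (T : finType) (lab : T -> nat) :=
  [/\ forall i, lab i < 4, #|[set i | lab i == 0]| = 1,
      #|[set i | lab i == 2]| = 3 & #|[set i | lab i == 3]| = 1].

Definition compatible (k l : nat) := [|| k == 0, l == 0 | k == l].

(** In the first alternative a vertex off [S] has degree at most n - 5 - d. The block bound alone
    gives d = |S| - 1, which is zero for |S| = 1; there parity improves it to 2, unless a block has
    n - 5 vertices, and that case yields the labelling. *)
Lemma extremal_structure (T : finType) (G : rel T) :
  simple_graph G -> connected_graph G -> one_binding G -> ~~ odd #|T| ->
  ~~ has_pm G ->
  (exists (S : {set T}) (d : nat),
    [/\ 0 < #|S|, 2 * #|S| + 6 <= #|T|, d = (if #|S| == 1 then 2 else #|S|.-1) &
     forall v, v \notin S ->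
       #|[set u | (u \notin S) && G v u]| + #|S| + 5 + d <= #|T|]) \/
  (exists2 lab, special_labelling lab &
     forall u v, G u v -> compatible (lab u) (lab v)).
Proof.
move=> Gsimp Gconn Gbind oddn npm.
have [G' [S [E [[G'simp sub] trans cE [ES Ei] Eo]]]] := tutte_structure Gsimp npm oddn.
have [G's G'i] := G'simp.
have few : #|singles G' S E| <= #|S|.
  have [->|X0] := eqVneq (singles G' S E) set0; first by rewrite cards0.
  (* Singleton components have all their neighbours in [S] and lie outside it themselves, so
     1-binding applies to the set of them. *)
  have sN : nbhd G (singles G' S E) \subset S.
    apply/subsetP => y; rewrite inE => /exists_inP[e]; rewrite inE => /andP[eE /eqP e1] Gey.
    apply: contraTT Gey => yS; apply/negP => /sub Gey.
    have : #|[set e; y]| <= #|block G' S e|.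
      apply: subset_leq_card; apply/subsetP => w.
      by rewrite !inE => /orP[]/eqP->; [rewrite eqxx ES|rewrite yS Gey orbT].
    rewrite cards2 e1; case: eqP => // ey; by rewrite -ey G'i in Gey.
  apply: leq_trans (subset_leq_card sN); apply: Gbind => //.
  have /set0Pn[e] := X0; rewrite inE => /andP[/ES eS _].
  by apply: contraNneq eS => NT; apply: (subsetP sN); rewrite NT.
(* With [S] empty a walk in [G] could never leave a block, yet [E] has members in two different
   blocks. *)
have s0 : 0 < #|S|.
  rewrite card_gt0; apply/eqP => S0.
  have : 1 < #|E| by move: cE; rewrite S0 cards0.
  case/card_gt1P=> e [f [eE fE ef]].
  have /connectP[p pp fl] := Gconn e f.
  have stay q x : path G x q -> x \in block G' S e -> last x q \in block G' S e.
    elim: q x => //= w q IH x /andP[xw wq] xe; apply: IH => //.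
    by apply: (block_closed trans xe (sub _ _ xw)); rewrite S0 inE.
  have := stay p e pp (block_refl G' (ES e eE)).
  by rewrite -fl inE eq_sym (negPf ef) (negPf (Ei _ _ eE fE)) andbF.
have cT := card_T_ge G'simp trans ES Ei Eo few cE.
have cle := card_block_le G'simp trans ES Ei Eo few cE.
have cev := card_even_block_le G'simp trans ES Ei Eo few cE.
have outd v : v \notin S ->
    #|[set u | (u \notin S) && G v u]| < #|block G' S v|.
  move=> vS; apply: leq_trans (block_outdeg G'simp vS); rewrite ltnS.
  apply/subset_leq_card/subsetP => u; rewrite !inE => /andP[-> /sub ->] //.
have [s1|s1] := eqVneq #|S| 1; last first.
  left; exists S, #|S|.-1; rewrite (negPf s1); split=> // v vS.
  have := outd v vS; have := cle v vS; lia.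
have [/existsP[v /andP[vS /eqP cv]]|h] :=
  boolP [exists v, (v \notin S) && (#|block G' S v| + 5 == #|T|)]; last first.
  left; exists S, 2; move: cT; rewrite s1; split=> // v vS.
  (* As n is even, an odd block of size other than n - 5 has at most n - 7 vertices, and an even
     block at most n - 8. *)
  have := outd v vS; have := cle v vS; have := cev v vS; rewrite s1.
  have : #|block G' S v| + 5 != #|T|.
    by apply: contra h => h; apply/existsP; exists v; rewrite vS.
  move: oddn; lia.
right.
have [e [eS ce dis]] := exists_triple G'simp trans ES Ei Eo few cE s1 vS cv.
pose lab u := if u \in S then 0 else if u \in block G' S v then 1 else
  if u \in block G' S e then 2 else 3.
have dis' w : w \in block G' S e -> w \notin block G' S v.
  by move=> we; rewrite (disjointFr dis we).
have bS w x : w \in block G' S x -> w \notin S by rewrite inE => /andP[].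
have E0 : [set i | lab i == 0] = S.
  by apply/setP=> i; rewrite inE /lab; do 3 (case: ifP => // _).
have E1 : [set i | lab i == 1] = block G' S v.
  apply/setP=> i; rewrite inE /lab; case: ifP => [iS|_].
    by apply/esym/negbTE; apply: contraL iS; exact: bS.
  by case: ifP => //; case: ifP.
have E2 : [set i | lab i == 2] = block G' S e.
  apply/setP=> i; rewrite inE /lab; case: ifP => [iS|_].
    by apply/esym/negbTE; apply: contraL iS; exact: bS.
  case: ifP => [iv|_]; last by case: ifP.
  by apply/esym/negbTE; apply: contraL iv; exact: dis'.
have lab4 i : lab i < 4 by rewrite /lab; do 3 (case: ifP => // _).
exists lab; first split=> //.
- by rewrite E0.
- by rewrite E2.
- have := cardsC (S :|: block G' S v :|: block G' S e).
  have -> : ~: (S :|: block G' S v :|: block G' S e) = [set i | lab i == 3].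
    apply/setP=> i; rewrite in_setC !in_setU [RHS]inE /lab.
    by case: (i \in S) => //; case: (i \in block G' S v) => //; case: (i \in _).
  rewrite cardsU cardsU_block.
  have -> : (S :|: block G' S v) :&: block G' S e = set0.
    apply/setP=> i; rewrite in_set0; apply/negbTE; rewrite in_setI.
    apply/negP => /andP[h ie]; move: h; rewrite in_setU (negPf (dis' _ ie)).
    by rewrite (negPf (bS _ _ ie)).
  rewrite cards0 s1 ce; move: cv; lia.
move=> u w /sub Guw; rewrite /compatible /lab.
have [//|uS] := boolP (u \in S); have [_|wS] := boolP (w \in S); first by rewrite orbT.
have cl x : (u \in block G' S x) = (w \in block G' S x).
  apply/idP/idP => h; first exact: (block_closed trans h Guw wS).
  by apply: (block_closed trans h) => //; rewrite G's.
by rewrite !cl eqxx !orbT.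
Qed.

(** * Collatz-Wielandt bounds *)

Local Open Scope ring_scope.

Section Collatz.
Variables (R : realFieldType) (alpha : R).
Hypotheses (alpha_ge0 : 0 <= alpha) (alpha_lt1 : alpha < 1).

(** This is the product of A_alpha(G) with the column vector [y]. *)
Definition alpha_op (T : finType) (G : rel T) (y : T -> R) (v : T) : R :=
  alpha * ((deg G v)%:R * y v) + (1 - alpha) * \sum_(u | G v u) y u.

Lemma alpha_op_lin (T : finType) (G : rel T) c y x v :
  alpha_op G (fun u => c * y u - x u) v = c * alpha_op G y v - alpha_op G x v.
Proof. by rewrite /alpha_op sumrB -mulr_sumr; ring. Qed.

Lemma alpha_op_norm (T : finType) (G : rel T) x v :
  `|alpha_op G x v| <= alpha_op G (fun u => `|x u|) v.
Proof.
rewrite /alpha_op; apply: le_trans (ler_normD _ _) _.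
rewrite !normrM (ger0_norm alpha_ge0) normr_nat (gtr0_norm (_ : 0 < 1 - alpha)) ?subr_gt0 //.
rewrite lerD2l; apply: ler_wpM2l; first by rewrite subr_ge0 ltW.
exact: ler_norm_sum.
Qed.

Lemma A_alpha_mulE n (G : rel 'I_n) (x : 'rV[R]_n) j : symmetric G ->
  (x *m A_alpha alpha G) 0 j = alpha_op G (x 0) j.
Proof.
move=> Gs; rewrite mxE /alpha_op mulr_sumr [in RHS]big_mkcond /=.
have -> : alpha * ((deg G j)%:R * x 0 j) =
    \sum_i (if i == j then alpha * ((deg G j)%:R * x 0 j) else 0).
  by rewrite -big_mkcond big_pred1_eq.
rewrite -big_split; apply: eq_bigr => i _ /=.
rewrite mxE Gs; case: eqP => [->|_]; case: (G j _); rewrite /= ?mulr1n ?mulr0n; ring.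
Qed.

(** Scale [y] by the least [M] for which M y dominates |x|, where x is an eigenvector for [r]. Where
    the slack [D] vanishes its image under [alpha_op] is nonnegative, and comparing the two sides
    there gives r <= t. *)
Lemma collatz n (G : rel 'I_n) (y : 'I_n -> R) (t r : R) :
  symmetric G -> (forall v, 0 < y v) -> (forall v, alpha_op G y v <= t * y v) ->
  eigenvalue (A_alpha alpha G) r ->
  r <= t /\ (connected_graph G -> r = t -> forall v, alpha_op G y v = t * y v).
Proof.
move=> Gs y0 yt /eigenvalueP[x xr x0].
have xE j : alpha_op G (x 0) j = r * x 0 j by rewrite -A_alpha_mulE // xr mxE.
have [i0 xi0] : exists i, x 0 i != 0.
  apply/existsP; rewrite -negb_forall; apply: contra x0 => /forallP h.
  by apply/eqP/rowP => i; rewrite mxE; apply/eqP; exact: h.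
case: (@Order.TotalTheory.arg_maxP _ R _ i0 predT (fun i => `|x 0 i| / y i) isT) => i1 _ max1.
set M := `|x 0 i1| / y i1 in max1.
have M0 : 0 < M.
  by apply: lt_le_trans (max1 i0 isT); rewrite divr_gt0 // normr_gt0.
have xM i : `|x 0 i| <= M * y i by rewrite -ler_pdivrMr //; exact: max1.
have D0 i : 0 <= M * y i - `|x 0 i| by rewrite subr_ge0.
pose D i := M * y i - `|x 0 i|.
have opD j : D j = 0 -> alpha_op G D j = (1 - alpha) * \sum_(u | G j u) D u.
  by move=> Dj; rewrite /alpha_op Dj; ring.
have opD0 j : D j = 0 -> 0 <= alpha_op G D j.
  move=> /opD->; apply: mulr_ge0; first by rewrite subr_ge0 ltW.
  by apply: sumr_ge0 => u _; exact: D0.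
have opDle j : alpha_op G D j <= M * alpha_op G y j - r * `|x 0 j|.
  rewrite /D alpha_op_lin lerD2l lerN2.
  apply: le_trans (alpha_op_norm G (x 0) j); rewrite xE normrM.
  by rewrite ler_wpM2r // ler_norm.
have Di1 : D i1 = 0 by rewrite /D /M divfK ?subrr // gt_eqF.
have tight j : D j = 0 -> `|x 0 j| = M * y j by move/eqP; rewrite subr_eq0 => /eqP->.
have My j : M * alpha_op G y j <= M * (t * y j) by rewrite ler_pM2l.
have rt : r <= t.
  have := opD0 _ Di1; have := opDle i1; have := My i1; rewrite (tight _ Di1) => h1 h2 h3.
  have : r * (M * y i1) <= t * (M * y i1) by lra.
  by rewrite ler_pM2r // mulr_gt0.
split=> // Gconn rE.
(* If r = t, a zero of [D] forces zeros at all its neighbours; connectedness then spreads them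
   everywhere. *)
have main j : D j = 0 -> alpha_op G y j = t * y j /\ forall u, G j u -> D u = 0.
  move=> Dj; have := opD0 _ Dj; have := opDle j; have := My j.
  rewrite (tight _ Dj) rE => h1 h2 h3; split.
    by apply: (mulfI (lt0r_neq0 M0)); lra.
  have /eqP : alpha_op G D j = 0 by lra.
  rewrite opD // mulf_eq0 subr_eq0 gt_eqF //= psumr_eq0; last by move=> u _; exact: D0.
  by move=> /allP h u Gju; have /implyP/(_ Gju)/eqP := h u (mem_index_enum _).
suff all0 j : D j = 0 by move=> v; case: (main v (all0 v)).
have /connectP[p pp ->] := Gconn i1 j.
elim: p (i1) Di1 pp => //= w p IH i Di /andP[iw wp].
by apply: IH => //; have [_] := main i Di; apply.
Qed.

(** The test vector is 1 on [S] and [z] off it. The two inequalities are its rows on and off [S],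
    with every neighbour count replaced by its maximum. *)
Lemma uniform_bound n (G : rel 'I_n) (S : {set 'I_n}) (D : nat) (t z r : R) :
  simple_graph G ->
  (forall v, v \notin S -> #|[set u | (u \notin S) && G v u]| <= D)%N ->
  0 < z ->
  alpha * (n%:R - 1) + (1 - alpha) * (#|S|%:R - 1 + (n%:R - #|S|%:R) * z) <= t ->
  alpha * ((#|S|%:R + D%:R) * z) + (1 - alpha) * (#|S|%:R + D%:R * z) <= t * z ->
  eigenvalue (A_alpha alpha G) r -> r <= t.
Proof.
move=> [Gs Gi] outD z0 ht hz er.
pose y v := if v \in S then 1 else z.
have y0 v : 0 < y v by rewrite /y; case: ifP.
suff yt v : alpha_op G y v <= t * y v by case: (collatz Gs y0 yt er).
pose a := #|[set u | (u \in S) && G v u]|.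
pose b := #|[set u | (u \notin S) && G v u]|.
have degE : deg G v = (a + b)%N.
  rewrite /deg -(cardsID S) /a /b; congr (_ + _)%N; apply: eq_card => u; rewrite !inE //.
  by rewrite andbC.
have sumE : \sum_(u | G v u) y u = a%:R + b%:R * z.
  rewrite (bigID (mem S)) /=; congr (_ + _).
    rewrite (eq_bigr (fun=> 1)); last by move=> u /andP[_ uS]; rewrite /y uS.
    by rewrite sumr_const; congr (_%:R); apply: eq_card => u; rewrite !inE andbC.
  rewrite (eq_bigr (fun=> z)); last by move=> u /andP[_ /negPf uS]; rewrite /y uS.
  by rewrite sumr_const mulr_natl; congr (_ *+ _); apply: eq_card => u; rewrite !inE andbC.
rewrite /alpha_op sumE degE natrD.
have b1 : 0 < 1 - alpha by rewrite subr_gt0.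
have [vS|vS] := boolP (v \in S).
  have leb : (b <= n - #|S|)%N.
    have -> : (n - #|S|)%N = #|~: S| by rewrite -{1}[n]card_ord -(cardsC S) addKn.
    by apply/subset_leq_card/subsetP => u; rewrite !inE => /andP[].
  have lea : (a < #|S|)%N.
    rewrite (cardsD1 v S) vS add1n ltnS; apply/subset_leq_card/subsetP => u.
    rewrite !inE => /andP[-> Gvu]; rewrite andbT.
    by apply: contraTneq Gvu => ->; rewrite Gi.
  have sn : (#|S| <= n)%N by rewrite -[leqRHS]card_ord max_card.
  move: leb; rewrite -(ler_nat R) natrB // => leb.
  move: lea; rewrite -(ler_nat R) -natr1 => lea.
  have yv : y v = 1 by rewrite /y vS.
  rewrite yv !mulr1; apply: le_trans ht; apply: lerD.
    by rewrite ler_wpM2l //; lra.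
  rewrite ler_wpM2l ?(ltW b1) //; apply: lerD; first by lra.
  by rewrite ler_wpM2r // ltW.
have yv : y v = z by rewrite /y (negPf vS).
have leb := outD v vS.
have lea : (a <= #|S|)%N by apply/subset_leq_card/subsetP => u; rewrite !inE => /andP[].
move: leb lea; rewrite -!(ler_nat R) => leb lea.
rewrite yv; apply: le_trans hz; apply: lerD.
  by rewrite ler_wpM2l // ler_wpM2r ?(ltW z0) // addrC [leRHS]addrC lerD.
rewrite ler_wpM2l ?(ltW b1) //; apply: lerD => //.
by rewrite ler_wpM2r // ltW.
Qed.

End Collatz.

(** * The extremal graph *)

Definition labelled_graph (T : finType) (lab : T -> nat) : rel T :=
  fun u v => (u != v) && compatible (lab u) (lab v).

Lemma compatible_sym k l : compatible k l = compatible l k.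
Proof. by rewrite /compatible orbCA [k == l]eq_sym. Qed.

Lemma labelled_graph_sym (T : finType) (lab : T -> nat) :
  symmetric (labelled_graph lab).
Proof. by move=> u v; rewrite /labelled_graph eq_sym compatible_sym. Qed.

Lemma sum_label (V : nmodType) (T : finType) (lab : T -> nat) (P : pred nat) (F : nat -> V) :
  (forall i, lab i < 4)%N ->
  \sum_(u | P (lab u)) F (lab u) =
  \sum_(k < 4 | P k) F k *+ #|[set u | lab u == k]|.
Proof.
move=> lab4; rewrite (partition_big (fun u => Ordinal (lab4 u)) (fun k : 'I_4 => P k)) //.
apply: eq_bigr => k Pk; rewrite (eq_bigr (fun=> F k)); last first.
  by move=> u /andP[_ /eqP <-].
rewrite sumr_const; congr (_ *+ _); apply: eq_card => u; rewrite !inE unfold_in /= -val_eqE /=.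
by case: eqP => [->|]; rewrite ?andbF // Pk.
Qed.

Lemma card_label1 (T : finType) (lab : T -> nat) :
  special_labelling lab -> (#|[set u | lab u == 1%N]| + 5 = #|T|)%N.
Proof.
case=> lab4 c0 c2 c3.
have := @sum_label int T lab predT (fun=> 1) lab4.
rewrite !big_ord_recl big_ord0 /= /bump /= c0 c2 c3 sumr_const.
have -> : #|fun _ : T => true| = #|T| by apply: eq_card.
rewrite !natz addn0; lia.
Qed.

(** Equal label counts make the two tuples of labels rearrangements of each other; the count of
    label 1 follows from the other three. *)
Lemma special_labelling_perm n (lab lab' : 'I_n -> nat) :
  special_labelling lab -> special_labelling lab' ->
  exists f : {perm 'I_n}, forall x, lab x = lab' (f x).
Proof.
move=> sl sl'.
have cE (l : 'I_n -> nat) k :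
    count_mem k [tuple l i | i < n] = #|[set i | l i == k]|.
  rewrite -sum1_count big_map big_enum_cond /= -sum1_card.
  by apply: eq_bigl => i; rewrite !inE.
have : perm_eq [tuple lab i | i < n] [tuple lab' i | i < n].
  apply/allP => k; rewrite mem_cat => kin; rewrite /= !cE.
  have {kin} k4 : (k < 4)%N.
    by case/orP: kin => /mapP[i _ ->]; [case: sl|case: sl'].
  have [_ c0 c2 c3] := sl; have [_ c0' c2' c3'] := sl'.
  case: k k4 => [|[|[|[|]]]] // _; rewrite ?c0 ?c2 ?c3 ?c0' ?c2' ?c3' //.
  by have := card_label1 sl; rewrite -(card_label1 sl') => /addIn->.
case/tuple_permP => f fE; exists f => x.
have := congr1 (fun s => nth 0%N s x) fE.
by rewrite -!tnth_nth !tnth_mktuple.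
Qed.

(** [blk] puts vertex 0 in the class of K_{n-5}; the shift by one frees label 0 for the centre. *)
Definition special_label n (i : 'I_n) : nat :=
  if (i : nat) == 0%N then 0%N else (blk n i).+1.

Lemma special_graphE n : special_graph n =2 labelled_graph (@special_label n).
Proof.
move=> x y; rewrite /special_graph /labelled_graph /compatible /special_label.
by case: (val x =P 0%N) => [->|_]; case: (val y =P 0%N) => [->|_];
  rewrite ?eqxx ?orbT ?andbT //= eqSS.
Qed.

Lemma special_label_special n : (6 <= n)%N -> special_labelling (@special_label n).
Proof.
move=> n6.
have card_seg (a b : nat) : (a + b <= n)%N -> 
    #|[set i : 'I_n | (a <= i < a + b)%N]| = b.
  move=> abn; rewrite -sum1_card.
  rewrite (eq_bigl (fun i : 'I_n => (a <= i < a + b)%N)); last by move=> i; rewrite inE.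
  rewrite -(big_mkord (fun i => (a <= i < a + b)%N) (fun=> 1%N)).
  rewrite -(big_nat_widen 0 (a + b) n (fun i => a <= i)%N) //.
  by rewrite -(big_nat_widenl a 0 (a + b) predT) // sum_nat_const_nat addKn muln1.
split.
- by move=> i; rewrite /special_label /blk; do ?case: ifP.
- rewrite -[RHS](card_seg 0%N 1%N); last by lia.
  apply: eq_card => i; rewrite !inE /special_label /blk; do ?case: ifP; lia.
- rewrite -[RHS](card_seg (n - 4)%N 3%N); last by lia.
  apply: eq_card => i; rewrite !inE /special_label /blk; have := ltn_ord i;
   do ?case: ifP; lia.
- rewrite -[RHS](card_seg (n - 1)%N 1%N); last by lia.
  apply: eq_card => i; rewrite !inE /special_label /blk; have := ltn_ord i;
   do ?case: ifP; lia.
Qed.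

(** * The Perron root and vector of the extremal graph *)

Section SpecialPerron.
Variables (R : realType) (alpha : R) (n : nat).
Hypotheses (alpha_ge0 : 0 <= alpha) (alpha_le : alpha <= 2^-1) (n18 : (18 <= n)%N).
Local Notation N := (n%:R : R).

(* Eliminating the clique values from the eigenvector equations of the quotient
   matrix and clearing denominators leaves this quartic in t. *)
Definition special_quartic (t : R) : R :=
  (t - alpha * (N - 1)) * ((t - (N - 6) - alpha) * (t - 2 - alpha) * (t - alpha))
  - (1 - alpha) ^+ 2 * ((N - 5) * ((t - 2 - alpha) * (t - alpha))
     + 3 * ((t - (N - 6) - alpha) * (t - alpha))
     + (t - (N - 6) - alpha) * (t - 2 - alpha)).

(** By the intermediate value theorem on [t0, N - 1], a negative value at [t0] certifies a root
    beyond [t0], which will be an eigenvalue of H. *)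
Lemma special_quartic_root (t0 : R) : N - 5 <= t0 -> t0 <= N - 1 ->
  special_quartic t0 < 0 -> exists2 t, t0 < t & special_quartic t = 0.
Proof.
have N18 : 18 <= N by rewrite ler_nat.
have [a0 a1] := (alpha_ge0, alpha_le).
move=> t0ge t0le qt0.
pose p : {poly R} := ('X - (alpha * (N - 1))%:P) *
   (('X - (N - 6 + alpha)%:P) * ('X - (2 + alpha)%:P) * ('X - alpha%:P))
  - ((1 - alpha) ^+ 2)%:P * ((N - 5)%:P * (('X - (2 + alpha)%:P) * ('X - alpha%:P))
     + 3%:P * (('X - (N - 6 + alpha)%:P) * ('X - alpha%:P))
     + ('X - (N - 6 + alpha)%:P) * ('X - (2 + alpha)%:P)).
have pE t : p.[t] = special_quartic t.
  by rewrite /p /special_quartic !(hornerD, hornerN, hornerM, hornerX, hornerC); ring.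
(* At N - 1 each of the factors x, y, z is at least b, and the quartic becomes b times a sum of
   nonnegative differences. *)
have end1 : 0 <= special_quartic (N - 1).
  rewrite /special_quartic.
  set b := 1 - alpha; set x := N - 1 - (N - 6) - alpha.
  set y := N - 1 - 2 - alpha; set z := N - 1 - alpha.
  have b0 : 0 <= b by rewrite /b; lra.
  have bx : b <= x by rewrite /b /x; lra.
  have byy : b <= y by rewrite /b /y; lra.
  have bz : b <= z by rewrite /b /z; lra.
  have x0 : 0 <= x by lra.
  have y0 : 0 <= y by lra.
  have z0 : 0 <= z by lra.
  have h1 : b * (y * z) <= x * (y * z) by rewrite ler_wpM2r // mulr_ge0.
  have h2 : b * (x * z) <= y * (x * z) by rewrite ler_wpM2r // mulr_ge0.
  have h3 : b * (x * y) <= z * (x * y) by rewrite ler_wpM2r // mulr_ge0.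
  have h4 : (N - 5) * (b * (y * z)) <= (N - 5) * (x * (y * z)) by rewrite ler_wpM2l //; lra.
  have -> : N - 1 - alpha * (N - 1) = b * (N - 1) by rewrite /b; ring.
  have -> : b * (N - 1) * (x * y * z) - b ^+ 2 * ((N - 5) * (y * z) + 3 * (x * z) + x * y)
    = b * (((N - 5) * (x * (y * z)) - (N - 5) * (b * (y * z)))
           + 3 * (y * (x * z) - b * (x * z)) + (z * (x * y) - b * (x * y))) by ring.
  by rewrite mulr_ge0 //; lra.
have [|t] := @poly_ivt R p t0 (N - 1) t0le; first by rewrite !pE end1 ltW.
move=> /andP[tl _] /rootP rt.
exists t; last by rewrite -pE.
rewrite lt_neqAle tl andbT; apply: contraTneq qt0 => ->.
by rewrite -pE rt ltxx.
Qed.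

(** N - 5 is the largest eigenvalue of the clique K_{n-4} formed by the centre and K_{n-5}; the
    terms of that clique cancel, and only negative ones remain. *)
Lemma special_quartic_lt0 : special_quartic (N - 5) < 0.
Proof.
have N18 : 18 <= N by rewrite ler_nat.
have [a0 a1] := (alpha_ge0, alpha_le).
rewrite /special_quartic.
set b := 1 - alpha; set y := N - 5 - 2 - alpha; set z := N - 5 - alpha.
have b0 : 0 < b by rewrite /b; lra.
have y0 : 0 < y by rewrite /y; lra.
have z0 : 0 < z by rewrite /z; lra.
have -> : N - 5 - (N - 6) - alpha = b by rewrite /b; ring.
have -> : N - 5 - alpha * (N - 1) = b * (N - 5) - 4 * alpha by rewrite /b; ring.
have -> : (b * (N - 5) - 4 * alpha) * (b * y * z) - b ^+ 2 * ((N - 5) * (y * z) + 3 * (b * z) + b * y)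
  = - (4 * alpha * (b * y * z) + b ^+ 3 * (3 * z + y)) by ring.
rewrite oppr_lt0 ltr_wpDl //.
  by rewrite !mulr_ge0 // ltW.
by rewrite mulr_gt0 ?exprn_gt0 //; lra.
Qed.

(** With value 1 at the centre, the eigenvector equation on a clique K_m has the solution (1 -
    alpha) / (t - (m - 1) - alpha). *)
Definition special_weight (t : R) (k : nat) : R :=
  match k with
  | 0 => 1
  | 1 => (1 - alpha) / (t - (N - 6) - alpha)
  | 2 => (1 - alpha) / (t - 2 - alpha)
  | _ => (1 - alpha) / (t - alpha)
  end.

Lemma special_weight_gt0 (t : R) k : N - 5 <= t -> 0 < special_weight t k.
Proof.
have N18 : 18 <= N by rewrite ler_nat.
have [a0 a1] := (alpha_ge0, alpha_le).
move=> tN; case: k => [|[|[|k]]] //=; rewrite divr_gt0 //; lra.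
Qed.

(** The clique equations hold by the choice of weights. The defect at the centre is minus the
    quartic over the product of the three denominators. *)
Lemma special_eigen (T : finType) (lab : T -> nat) (t : R) v : #|T| = n ->
  special_labelling lab -> N - 5 <= t -> special_quartic t = 0 ->
  alpha_op alpha (labelled_graph lab) (fun u => special_weight t (lab u)) v =
  t * special_weight t (lab v).
Proof.
have N18 : 18 <= N by rewrite ler_nat.
have [a0 a1] := (alpha_ge0, alpha_le).
move=> cT sl tN qt; have [lab4 c0 c2 c3] := sl.
have c1 : (#|[set u | lab u == 1%N]|)%:R = N - 5.
  by rewrite -cT -(card_label1 sl) natrD; ring.
pose c : seq R := [:: 1; N - 5; 3; 1].
have cE (k : 'I_4) : (#|[set u | lab u == k]|)%:R = c`_k :> R.
  by case: k => -[|[|[|[|]]]] //= _; rewrite ?c0 ?c1 ?c2 ?c3.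
(* Summing over all compatible labels also counts [v] itself, which is subtracted. *)
have sumE (F : nat -> R) : \sum_(u | labelled_graph lab v u) F (lab u) =
    \sum_(k < 4) (if compatible (lab v) k then F k * c`_k else 0) - F (lab v).
  under [in RHS]eq_bigr do rewrite -cE mulr_natr.
  rewrite -big_mkcond /= -(sum_label _ _ lab4).
  rewrite [X in _ = X - _](bigD1 v) /=; last by rewrite /compatible eqxx !orbT.
  rewrite [RHS]addrC addKr; apply: eq_bigl => u.
  by rewrite /labelled_graph eq_sym andbC.
have degE : (deg (labelled_graph lab) v)%:R =
    \sum_(k < 4) (if compatible (lab v) k then 1 * c`_k else 0) - 1 :> R.
  rewrite -(sumE (fun=> 1)) sumr_const; congr (_%:R).
  by apply: eq_card => u; rewrite inE.
rewrite /alpha_op sumE degE !big_ord_recl !big_ord0.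
have x0 : t - (N - 6) - alpha != 0 by apply: lt0r_neq0; lra.
have y0 : t - 2 - alpha != 0 by apply: lt0r_neq0; lra.
have z0 : t - alpha != 0 by apply: lt0r_neq0; lra.
have := lab4 v; case: (lab v) => [|[|[|[|]]]] //= _.
- apply/eqP; rewrite -subr_eq0; apply/eqP.
  transitivity (- special_quartic t / ((t - (N - 6) - alpha) * (t - 2 - alpha) * (t - alpha))).
    by rewrite /special_quartic; field; rewrite x0 y0 z0.
  by rewrite qt oppr0 mul0r.
- by field.
- by field.
- by field.
Qed.

End SpecialPerron.

(** * Comparison of spectral radii *)

Lemma alpha_op_eq (R : realFieldType) (alpha : R) (T : finType) (G H : rel T) y v :
  G =2 H -> alpha_op alpha G y v = alpha_op alpha H y v.
Proof.
move=> GH; rewrite /alpha_op /deg; congr (_ * (_%:R * _) + _ * _).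
  by apply: eq_card => u; rewrite !inE GH.
by apply: eq_bigl => u; rewrite GH.
Qed.

(** Every missing neighbour lowers the value by a positive amount, because [y] is positive and alpha
    < 1. *)
Lemma alpha_op_subrel (R : realFieldType) (alpha : R) (T : finType) (G H : rel T) y v :
  0 <= alpha -> alpha < 1 -> (forall u, 0 < y u) -> subrel G H ->
  alpha_op alpha G y v <= alpha_op alpha H y v /\
  (alpha_op alpha G y v = alpha_op alpha H y v -> G v =1 H v).
Proof.
move=> a0 a1 y0 GH.
have b0 : 0 < 1 - alpha by rewrite subr_gt0.
have le1 : alpha * ((deg G v)%:R * y v) <= alpha * ((deg H v)%:R * y v).
  rewrite ler_wpM2l // ler_wpM2r ?(ltW (y0 v)) // ler_nat.
  by apply/subset_leq_card/subsetP => u; rewrite !inE; exact: GH.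
have sumE : \sum_(u | H v u) y u =
    \sum_(u | G v u) y u + \sum_(u | H v u && ~~ G v u) y u.
  rewrite (bigID (G v)) /=; congr (_ + _); apply: eq_bigl => u.
  by case Gvu: (G v u); rewrite ?andbF // (GH _ _ Gvu).
have ge0 : 0 <= \sum_(u | H v u && ~~ G v u) y u.
  by apply: sumr_ge0 => u _; exact: ltW.
have le2 : (1 - alpha) * \sum_(u | G v u) y u <= (1 - alpha) * \sum_(u | H v u) y u.
  by rewrite ler_pM2l // sumE lerDl.
rewrite /alpha_op; split=> [|e u]; first exact: lerD.
have {}e : (1 - alpha) * \sum_(u | H v u && ~~ G v u) y u = 0.
  have : (1 - alpha) * \sum_(u | H v u) y u = (1 - alpha) * \sum_(u | G v u) y u by lra.
  by rewrite sumE mulrDr => h; lra.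
apply/idP/idP; first exact: GH.
move=> Hvu; apply/negPn/negP => Gvu; move/eqP: e; apply/negP.
rewrite mulf_neq0 ?gt_eqF // (bigD1 u) /= ?Hvu // ltr_wpDr //.
by apply: sumr_ge0 => w _; exact: ltW.
Qed.

Lemma special_quartic_eigenvalue (R : realType) (alpha : R) (n : nat) (t : R) :
  0 <= alpha -> alpha <= 2^-1 -> (18 <= n)%N -> n%:R - 5 <= t ->
  special_quartic alpha n t = 0 -> eigenvalue (A_alpha alpha (special_graph n)) t.
Proof.
move=> a0 a1 n18 tn qt.
have sl : special_labelling (@special_label n).
  by apply: special_label_special; exact: leq_trans n18.
have sym : symmetric (special_graph n).
  by move=> x y; rewrite !special_graphE labelled_graph_sym.
apply/eigenvalueP; exists (\row_i special_weight alpha n t (special_label i)).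
  apply/rowP => i; rewrite A_alpha_mulE // (alpha_op_eq _ _ _ (@special_graphE n)) !mxE.
  rewrite -(special_eigen a0 a1 n18 i (card_ord n) sl tn qt).
  rewrite /alpha_op; congr (_ * (_ * _) + _ * _); first by rewrite mxE.
  by apply: eq_bigr => u _; rewrite mxE.
have n0 : (0 < n)%N by exact: leq_trans n18.
apply/eqP => /rowP/(_ (Ordinal n0)); rewrite !mxE => /eqP.
by rewrite gt_eqF // special_weight_gt0.
Qed.

(** Testing [G] with the Perron vector of H gives rhoG <= t <= rhoH <= rhoG. The equality case of
    [collatz], followed by that of [alpha_op_subrel], leaves no edge of H missing. *)
Lemma labelled_extremal (R : realType) (alpha : R) (n : nat) (G : rel 'I_n)
    (rhoG rhoH : R) (lab : 'I_n -> nat) :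
  0 <= alpha -> alpha <= 2^-1 -> simple_graph G -> connected_graph G -> (18 <= n)%N ->
  is_largest_eigenvalue (A_alpha alpha G) rhoG ->
  is_largest_eigenvalue (A_alpha alpha (special_graph n)) rhoH ->
  rhoH <= rhoG -> special_labelling lab ->
  (forall u v, G u v -> compatible (lab u) (lab v)) ->
  isomorphic G (special_graph n).
Proof.
move=> a0 a1 [Gs Gi] Gconn n18 [eG _] [_ maxH] le sl Glab.
have n18R : 18 <= n%:R :> R by rewrite ler_nat.
have alt1 : alpha < 1 by lra.
have [|t tgt qt] := special_quartic_root a0 a1 n18 (lexx _) _ (special_quartic_lt0 a0 a1 n18).
  by lra.
have tn : n%:R - 5 <= t := ltW tgt.
have tH := maxH _ (special_quartic_eigenvalue a0 a1 n18 tn qt).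
pose y (v : 'I_n) := special_weight alpha n t (lab v).
have y0 v : 0 < y v by exact: special_weight_gt0.
have GL : subrel G (labelled_graph lab).
  move=> u v Guv; rewrite /labelled_graph Glab // andbT.
  by apply: contraTneq Guv => ->; rewrite Gi.
have yE v := special_eigen a0 a1 n18 v (card_ord n) sl tn qt.
have yt v : alpha_op alpha G y v <= t * y v.
  by rewrite -yE; case: (alpha_op_subrel v a0 alt1 y0 GL).
have [rt eqc] := collatz a0 alt1 Gs y0 yt eG.
have tG : rhoG = t by apply/eqP; rewrite eq_le rt (le_trans tH).
have GE v : G v =1 labelled_graph lab v.
  case: (alpha_op_subrel v a0 alt1 y0 GL) => _; apply.
  by rewrite yE (eqc Gconn tG).
have sl' : special_labelling (@special_label n).
  by apply: special_label_special; exact: leq_trans n18.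
have [f fE] := special_labelling_perm sl sl'.
exists f => u v; rewrite GE special_graphE /labelled_graph !fE.
by rewrite (inj_eq perm_inj).
Qed.

(* This is 4 (d + b s) <= b d (n - s) at b = 1 - alpha = 1/2, its worst case. *)
Lemma separation_ineq (s d n : nat) : (0 < s)%N -> (2 * s + 6 <= n)%N -> (18 <= n)%N ->
  d = (if s == 1%N then 2 else s.-1)%N ->
  ((n == 18) && (s == 6))%N \/ (8 * d + 4 * s <= d * (n - s))%N.
Proof.
move=> s0 sn n18 ->; have [ns|/negPf ns] := boolP ((n == 18) && (s == 6))%N; first by left.
right; move: ns s0 sn; case: s => [|[|[|[|[|[|[|s]]]]]]] //=; try lia.
move=> _ _ sn; nia.
Qed.

(** The value [z] is chosen to make the row off [S] an equality at t = n - 5; the row on [S],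
    multiplied by [w], is then exactly the assumed inequality. *)
Lemma separated_bound (R : realType) (alpha : R) (n d : nat) (G : rel 'I_n)
    (S : {set 'I_n}) (r : R) :
  0 <= alpha -> alpha <= 2^-1 -> simple_graph G ->
  (0 < #|S|)%N -> (0 < d)%N ->
  (#|S| + 5 + d <= n)%N ->
  (forall v, v \notin S -> #|[set u | (u \notin S) && G v u]| + #|S| + 5 + d <= n)%N ->
  4 * (d%:R + (1 - alpha) * #|S|%:R) <= (1 - alpha) * (d%:R * (n%:R - #|S|%:R)) ->
  eigenvalue (A_alpha alpha G) r -> r <= n%:R - 5.
Proof.
move=> a0 a1 Gsimp s0 d0 sd out h.
have alt1 : alpha < 1 by lra.
have b0 : 0 < 1 - alpha by lra.
have s0R : 0 < #|S|%:R :> R by rewrite ltr0n.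
have d0R : 0 < d%:R :> R by rewrite ltr0n.
set w := d%:R + (1 - alpha) * #|S|%:R in h.
have w0 : 0 < w by rewrite addr_gt0 // mulr_gt0.
pose z := (1 - alpha) * #|S|%:R / w.
have zw : z * w = (1 - alpha) * #|S|%:R by rewrite /z divfK // gt_eqF.
apply: (@uniform_bound _ alpha a0 alt1 n G S (n - (#|S| + 5 + d))%N _ z) => //.
- by move=> v vS; have := out v vS; lia.
- by rewrite divr_gt0 // mulr_gt0.
- rewrite -(ler_pM2r w0).
  have -> : (alpha * (n%:R - 1) + (1 - alpha) * (#|S|%:R - 1 + (n%:R - #|S|%:R) * z)) * w =
     (alpha * (n%:R - 1) + (1 - alpha) * (#|S|%:R - 1)) * w
      + (1 - alpha) * (n%:R - #|S|%:R) * (z * w) by ring.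
  rewrite zw -subr_ge0.
  suff -> : (n%:R - 5) * w - ((alpha * (n%:R - 1) + (1 - alpha) * (#|S|%:R - 1)) * w +
     (1 - alpha) * (n%:R - #|S|%:R) * ((1 - alpha) * #|S|%:R)) =
     (1 - alpha) * (d%:R * (n%:R - #|S|%:R)) - 4 * w by rewrite subr_ge0.
  by rewrite /w; ring.
rewrite natrB // !natrD -subr_ge0.
suff -> : (n%:R - 5) * z - (alpha * ((#|S|%:R + (n%:R - (#|S|%:R + 5 + d%:R))) * z) +
   (1 - alpha) * (#|S|%:R + (n%:R - (#|S|%:R + 5 + d%:R)) * z)) =
   z * w - (1 - alpha) * #|S|%:R by rewrite zw subrr.
by rewrite /w; ring.
Qed.

Theorem theorem1p1 (R : realType) (alpha : R) (n : nat) (G : rel 'I_n)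
    (rhoG rhoH : R) :
  0 <= alpha -> alpha <= 2^-1 ->
  simple_graph G -> connected_graph G -> one_binding G ->
  ~~ odd n ->
  (18 <= n)%N ->
  (alpha < 2^-1 -> (2 + 8 * alpha) / (1 - 2 * alpha) <= n%:R) ->
  is_largest_eigenvalue (A_alpha alpha G) rhoG ->
  is_largest_eigenvalue (A_alpha alpha (special_graph n)) rhoH ->
  rhoH <= rhoG ->
  has_perfect_matching G \/ isomorphic G (special_graph n).
Proof.
move=> a0 a1 Gsimp Gconn Gbind oddn n18 hn LG LH le.
have [pm|npm] := boolP (has_pm G); first by left; exact: has_pm_perfect_matching.
right.
have oddT : ~~ odd #|'I_n| by rewrite card_ord.
have [[S [d [s0 sn dE out]]]|[lab sl Glab]] :=
  extremal_structure Gsimp Gconn Gbind oddT npm; last first.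
  exact: (labelled_extremal a0 a1 Gsimp Gconn n18 LG LH le sl Glab).
exfalso.
have n18R : 18 <= n%:R :> R by rewrite ler_nat.
have [eG _] := LG; have [_ maxH] := LH.
(* A negative value of the quartic at [t0] gives rhoH > t0, so rhoG cannot be at most [t0]. *)
have beat t0 : n%:R - 5 <= t0 -> t0 <= n%:R - 1 -> special_quartic alpha n t0 < 0 ->
    rhoG <= t0 -> False.
  move=> h1 h2 h3 h4; have [t tgt qt] := special_quartic_root a0 a1 n18 h1 h2 h3.
  have := maxH _ (special_quartic_eigenvalue a0 a1 n18 (le_trans h1 (ltW tgt)) qt).
  by lra.
rewrite card_ord in sn out.
have d0 : (0 < d)%N by rewrite dE; case: eqP s0 => //; lia.
have sd : (#|S| + 5 + d <= n)%N by rewrite dE; case: eqP s0 sn => //; lia.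
have ssn : (#|S| <= n)%N by lia.
have fin : 4 * (d%:R + (1 - alpha) * #|S|%:R) <= (1 - alpha) * (d%:R * (n%:R - #|S|%:R)) -> False.
  move=> h; apply: (beat (n%:R - 5)); rewrite ?lexx //; first by lra.
    exact: special_quartic_lt0.
  exact: (separated_bound a0 a1 Gsimp s0 d0 sd out h eG).
have [/andP[/eqP nE /eqP sE]|] := separation_ineq s0 sn n18 dE; last first.
  (* The integer inequality is 8 d <= d (n - s) - 4 s; multiplying it by 1 - alpha, which is at
     least 1/2, gives the real one. *)
  rewrite -(ler_nat R) natrD !natrM natrB // => h; apply: fin.
  have d0R : 0 <= d%:R :> R by rewrite ler0n.
  have s0R : 0 <= #|S|%:R :> R by rewrite ler0n.
  set x := d%:R * _ in h *; nra.
have d5 : d = 5%N by rewrite dE sE.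
(* For n = 18 and s = 6 the inequality in [fin] amounts to alpha <= 4/9, while the assumed lower
   bound on n forces alpha <= 4/11. *)
have [a2|a2] := ltP alpha 2^-1.
  apply: fin; rewrite d5 sE nE.
  have := hn a2; rewrite nE ler_pdivrMr; last by lra.
  by lra.
have aE : alpha = 2^-1 by apply/eqP; rewrite eq_le a1.
have alt1 : alpha < 1 by lra.
(* At alpha = 1/2 the value z = 11/30 makes the row on [S] an equality at 66/5 and leaves a slack of
   1/150 off [S], where a vertex has at most 18 - 6 - 5 - 5 = 2 neighbours outside [S]. *)
apply: (beat (66 / 5)); rewrite ?nE; try lra.
  by rewrite /special_quartic aE; lra.
apply: (@uniform_bound _ alpha a0 alt1 n G S 2 _ (11 / 30)) eG => //.
- move=> v vS; have := leq_trans (out v vS) (eq_leq nE).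
  by rewrite sE d5 -!addnA -[18%N]/(2 + 16)%N leq_add2r.
- by lra.
- by rewrite aE sE nE; lra.
by rewrite aE sE; lra.
Qed.
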